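(* Let $(V,|0\rangle,T,Y)$ be a vertex algebra, and for $a,b\in V$ define $$[a_\lambda b]:=\mathrm{Res}_z\,e^{\lambda z}\,Y(a,z)b=\sum_{j\ge0}\frac{\lambda^j}{j!}a_{(j)}b .$$ Then this product is a $\lambda$-bracket, with $\partial=T$; that is, it endows $V$, regarded as a $\mathbb{C}[\partial]$-module with $\partial$ acting as $T$, with the structure of a Lie conformal superalgebra.
   Context: All vector spaces are over $\mathbb{C}$. A superspace is a $\mathbb{Z}_2$-graded space $V=V_{\bar 0}\oplus V_{\bar 1}$; for homogeneous $a,b$ put $p(a,b)=(-1)^{p(a)p(b)}$; formulas containing $p(a,b)$ are for homogeneous elements. An $\mathrm{End}(V)$-valued formal distribution $a(z)=\sum_{n\in\mathbb{Z}}a_{(n)}z^{-n-1}$ (all modes of the same parity) is a field if $a(z)v\in V[[z]][z^{-1}]$ for all $v\in V$. A pair is local if $(z-w)^N[a(z),b(w)]=0$ for some $N\ge0$, where $[a(z),b(w)]=a(z)b(w)-p(a,b)b(w)a(z)$; a local family is a set in which all pairs are local. $\mathrm{Res}_z$ is the coefficient of $z^{-1}$. A vertex algebra $(V,|0\rangle,T,Y)$ consists of a superspace $V$, a vector $|0\rangle\in V_{\bar 0}$, an even endomorphism $T$ of $V$, and a linear parity-preserving map $Y(\cdot,z)$ from $V$ to $\mathrm{End}(V)$-valued fields, $Y(a,z)=\sum_n a_{(n)}z^{-n-1}$, such that: $Y(|0\rangle,z)=\mathrm{Id}_V$, $Y(a,z)|0\rangle\in a+zV[[z]]$, $T|0\rangle=0$;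 $[T,Y(a,z)]=\partial_zY(a,z)$; $\{Y(a,z)\mid a\in V\}$ is a local family. For $a,b\in V$, $a_{(n)}b:=a_{(n)}(b)$. A Lie conformal superalgebra is a ($\mathbb{Z}_2$-graded) $\mathbb{C}[\partial]$-module $R$ with a $\mathbb{C}$-bilinear map ($\lambda$-bracket) $[\,\cdot\,_\lambda\,\cdot\,]:R\otimes R\to\mathbb{C}[\lambda]\otimes R$ such that for all $a,b,c\in R$: $[\partial a_\lambda b]=-\lambda[a_\lambda b]$; $[a_\lambda\partial b]=(\partial+\lambda)[a_\lambda b]$; $[b_\lambda a]=-p(a,b)[a_{-\lambda-\partial}b]$; $[a_\lambda[b_\mu c]]=[[a_\lambda b]_{\lambda+\mu}c]+p(a,b)[b_\mu[a_\lambda c]]$. Here if $[a_\lambda b]=\sum_j\frac{\lambda^j}{j!}a_{(j)}b$ then $[a_{-\lambda-\partial}b]=\sum_j\frac{(-\lambda-\partial)^j}{j!}(a_{(j)}b)$ with $\partial$ acting on $a_{(j)}b$. *)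

(* Defs.v *)
From mathcomp Require Import all_boot all_order all_algebra.
From mathcomp Require Import all_classical.

Set Implicit Arguments.
Unset Strict Implicit.
Unset Printing Implicit Defensive.

Import GRing.Theory.
Local Open Scope ring_scope.

(* Elements of Z/2Z are booleans: [false] is even, [true] is odd, and addition
   is [addb] (written (+)). *)
Record superspace (K : fieldType) := Superspace {
  ss_space :> lmodType K;
  part : bool -> set ss_space;
  part0 : forall p, part p 0;
  part_lin : forall p (k : K) u v,
    part p u -> part p v -> part p (k *: u + v);
  part_span : forall v, exists v0 v1,
    [/\ part false v0, part true v1 & v = v0 + v1];
  part_direct : forall v, part false v -> part true v -> v = 0
}.

Section FormalDistributions.

Variables (K : fieldType) (V : superspace K).

Definition endo_parity (p : bool) (f : V -> V) : Prop :=
  forall q v, part q v -> part (p (+) q) (f v).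

(* [A n] is the mode a_(n), that is the coefficient of z^(-n-1) in a(z). *)
Definition distribution : Type := int -> {linear V -> V}.

Definition dist_parity (p : bool) (A : distribution) : Prop :=
  forall n, endo_parity p (A n).

(* A(z)v is in V[[z]][z^-1]. *)
Definition field_like (A : distribution) : Prop :=
  forall v, exists N : int, forall n, N <= n -> A n v = 0.

Definition koszul (p q : bool) : K := (-1) ^+ (p && q).

(* The coefficient of z^(-m-1) w^(-n-1) in [a(z), b(w)], for a(z) and b(w) of
   parities [p] and [q]. *)
Definition scommutator (p q : bool) (A B : distribution) (m n : int) : V -> V :=
  fun v => A m (B n v) - koszul p q *: B n (A m v).

(* Multiplication by z - w of the distribution whose coefficient of
   z^(-m-1) w^(-n-1) is [F m n]. *)
Definition mul_zw (W : zmodType) (F : int -> int -> W) : int -> int -> W :=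
  fun m n => F (m + 1) n - F m (n + 1).

Definition local_pair (p q : bool) (A B : distribution) : Prop :=
  exists N : nat, forall m n v,
    iter N (@mul_zw (V -> V)) (scommutator p q A B) m n v = 0.

(* The supercommutator is given by its formula on distributions of definite
   parity; on sums of these it is its bilinear extension, so locality need
   only be required of the homogeneous pairs. *)
Definition local_family (F : set distribution) : Prop :=
  forall p q A B, F A -> F B -> dist_parity p A -> dist_parity q B ->
    local_pair p q A B.

End FormalDistributions.

Record vertex_algebra (K : fieldType) := VertexAlgebra {
  va_space :> superspace K;
  va_vac : va_space;
  va_T : {linear va_space -> va_space};
  va_Y : va_space -> distribution va_space;
  va_vac_even : part false va_vac;
  va_T_even : endo_parity false va_T;
  va_Y_linear : forall n v, linear (fun a => va_Y a n v);
  va_Y_parity : forall p a, part p a -> dist_parity p (va_Y a);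
  va_Y_field : forall a, field_like (va_Y a);
  va_Y_vac : forall n v, va_Y va_vac n v = if n == -1 then v else 0;
  va_Y_create : forall a, va_Y a (-1) va_vac = a;
  va_Y_regular : forall a n, 0 <= n -> va_Y a n va_vac = 0;
  va_T_vac : va_T va_vac = 0;
  (* The coefficient of z^(-n-1) in the z-derivative of Y(a, z) is
     -n a_(n-1). *)
  va_translation : forall a n v,
    va_T (va_Y a n v) - va_Y a n (va_T v) = - (n%:~R *: va_Y a (n - 1) v);
  va_local : local_family (range va_Y)
}.

Section LambdaBrackets.

Variables (K : fieldType) (V : lmodType K).

(* [f : nat -> V] stands for the power series \sum_k f(k) lambda^k, and
   C[lambda] (x) V is the space of those with finitely many nonzero
   coefficients. Such functions carry the pointwise module structure. *)
Definition is_lpoly (f : nat -> V) : Prop :=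
  exists N : nat, forall n, (N <= n)%N -> f n = 0.

Definition lconst (v : V) : nat -> V := fun n => if n is 0%N then v else 0.

Definition lmul (f : nat -> V) : nat -> V := fun n => if n is m.+1 then f m else 0.

(* The value at S of the polynomial \sum_k f(k) lambda^k, where S is an
   operator on W and the coefficients are embedded in W by [inj], i.e.
   \sum_k S^k (inj (f k)). The sum, over all of [nat], has finite support when
   [f] is polynomial. *)
Definition lsubst (U W : zmodType) (S : W -> W) (inj : U -> W) (f : nat -> U) : W :=
  \sum_(k \in [set: nat]) iter k S (inj (f k)).

(* f(- lambda - d), with d acting on the coefficients of f. *)
Definition subst_neg (d : V -> V) (f : nat -> V) : nat -> V :=
  lsubst (fun g => - lmul g - (d \o g)) lconst f.

(* [F m n] is the coefficient of lambda^m mu^n. *)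
Definition lmul2 (F : nat -> nat -> V) : nat -> nat -> V :=
  fun m n => if m is m'.+1 then F m' n else 0.

Definition mmul2 (F : nat -> nat -> V) : nat -> nat -> V := fun m => lmul (F m).

Definition lconst2 (v : V) : nat -> nat -> V :=
  fun m n => if (m == 0%N) && (n == 0%N) then v else 0.

Variable br : V -> V -> nat -> V.

(* [a_lambda [b_mu c]] *)
Definition br_lm (a b c : V) : nat -> nat -> V := fun m n => br a (br b c n) m.

(* [b_mu [a_lambda c]] *)
Definition br_ml (b a c : V) : nat -> nat -> V := fun m n => br b (br a c m) n.

(* [x_(lambda + mu) c] *)
Definition br_sum (x c : V) : nat -> nat -> V :=
  lsubst (fun F : nat -> nat -> V => lmul2 F + mmul2 F) lconst2 (br x c).

(* [[a_lambda b]_(lambda + mu) c] *)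
Definition br_br_sum (a b c : V) : nat -> nat -> V :=
  lsubst lmul2 (fun x => br_sum x c) (br a b).

End LambdaBrackets.

(* [br a b k] is the coefficient of lambda^k in [a_lambda b] (without the
   factor 1/k!), and [d] is the action of the indeterminate of the polynomial
   ring acting on V. *)
Record lie_conformal_superalgebra (K : fieldType) (V : superspace K)
    (d : {linear V -> V}) (br : V -> V -> nat -> V) : Prop := {
  lcs_d_even : endo_parity false d;
  lcs_poly : forall a b, is_lpoly (br a b);
  lcs_linear_l : forall b, linear (fun a => br a b);
  lcs_linear_r : forall a, linear (br a);
  lcs_parity : forall p q a b k,
    part p a -> part q b -> part (p (+) q) (br a b k);
  lcs_sesq_l : forall a b, br (d a) b = - lmul (br a b);
  lcs_sesq_r : forall a b, br a (d b) = (d \o br a b) + lmul (br a b);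
  lcs_skew : forall p q a b, part p a -> part q b ->
    br b a = - (koszul K p q *: subst_neg d (br a b));
  lcs_jacobi : forall p q a b c, part p a -> part q b ->
    br_lm br a b c = br_br_sum br a b c + koszul K p q *: br_ml br b a c
}.

(* Distributions with values in W are again indexed by modes: [c n] is the
   coefficient of z^(-n-1), so that Res_z is the value at 0. *)
Definition residue (W : zmodType) (c : int -> W) : W := c 0.

Definition zmul (W : zmodType) (j : nat) (c : int -> W) : int -> W :=
  fun n => c (n + j%:Z).

(* Res_z e^(lambda z) Y(a, z) b: the coefficient of lambda^j in e^(lambda z) is
   z^j / j!. *)
Definition va_bracket (K : fieldType) (V : vertex_algebra K) (a b : V) : nat -> V :=
  fun j => residue (fun n => (j`!%:R)^-1 *: zmul j (fun m => va_Y a m b) n).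

Lemma va_bracketE (K : fieldType) (V : vertex_algebra K) (a b : V) (j : nat) :
  va_bracket a b j = (j`!%:R)^-1 *: va_Y a j%:Z b.
Proof. by rewrite /va_bracket /residue /zmul add0r. Qed.

(* Main.v *)
From HB Require Import structures.
Require Import Defs.
From mathcomp Require Import all_boot all_order all_algebra.
From mathcomp Require Import all_classical all_reals complex.
From mathcomp Require Import zify ring.

Set Implicit Arguments.
Unset Strict Implicit.
Unset Printing Implicit Defensive.

Import Order.TTheory GRing.Theory Num.Theory.
Local Open Scope ring_scope.

(** Everything is done on modes. A formal distribution in z and w is the array
    F m n of its coefficients of z^(-m-1) w^(-n-1), and multiplication by z - w
    is a difference operator on such arrays, so that locality of a pair says
    that a power of this operator kills the supercommutator.

    The heart of the matter is that, for j >= 0, the residue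
    C_j(w) = Res_z (z-w)^j [Y(a,z), Y(b,w)] is Y(a_(j) b, w) ([res_prodE]).
    This is a uniqueness statement: a translation covariant family E of modes
    that is local with every Y(d,w) and whose modes E_n, n >= -1, kill the
    vacuum is zero ([covariant_local_eq0]). Indeed covariance forces all E_n to
    kill the vacuum, and then locality transports the vanishing to any vector d,
    which is the value of Y(d,w) at w = 0 on the vacuum. It is applied to the
    difference E = C_j - Y(a_(j) b), whose locality is Dong's lemma
    ([dong_locality], [res_prod_local]): by the Jacobi identity of
    supercommutators, [[a(z), b(w)], d(u)] is a sum of one term killed by a
    power of w - u and one killed by a power of z - u, while a power of z - w
    kills the whole; since w - u = (z - u) - (z - w), a power of w - u kills it.

    Everything else consists in expanding [Y(a,z), Y(b,w)] in the C_j.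
    - The binomial expansion of z^m = ((z - w) + w)^m for m >= 0 gives the
      commutator formula for a_(m) b_(n), with coefficients C(m, j); divided by
      m! n! it is the Jacobi identity of the lambda-bracket.
    - The geometric expansion of z^(-1) = (w + (z - w))^(-1), finite by
      locality, applied to the vacuum gives b_(n) a in terms of the modes of
      a_(j) b on the vacuum, which are T^k (a_(j) b) / k!; this is
      skew-symmetry.
    - Sesquilinearity on the right is the translation axiom; on the left it is
      Y(T a, z) = d/dz Y(a, z), a second application of uniqueness.

    Characteristic zero is used for uniqueness and for dividing by
    factorials. *)

(** * Nilpotency of iterated additive maps *)

Lemma subrACA (U : zmodType) (x y z t : U) :
  (x - y) - (z - t) = (x - z) - (y - t).
Proof. by rewrite !opprD !addrA [x - y - z]addrAC. Qed.

Section Iterates.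

Variable U : zmodType.

Lemma iter_additive0 (f : {additive U -> U}) n : iter n f 0 = 0.
Proof. by elim: n => //= n ->; rewrite raddf0. Qed.

Lemma iter_additiveD (f : {additive U -> U}) n :
  {morph iter n f : x y / x + y}.
Proof. by move=> x y; elim: n => //= n ->; rewrite raddfD. Qed.

Lemma iter_additiveB (f : {additive U -> U}) n :
  {morph iter n f : x y / x - y}.
Proof. by move=> x y; elim: n => //= n ->; rewrite raddfB. Qed.

Lemma iter_additive_eq0W (f : {additive U -> U}) m n x :
  (m <= n)%N -> iter m f x = 0 -> iter n f x = 0.
Proof. by move=> /subnK <- fx0; rewrite iterD fx0 iter_additive0. Qed.

Lemma iter_commute1 (f g : U -> U) n x :
  (forall y, f (g y) = g (f y)) -> f (iter n g x) = iter n g (f x).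
Proof. by move=> fg; elim: n => //= n <-. Qed.

Lemma iter_commute (f g : U -> U) m n x :
  (forall y, f (g y) = g (f y)) ->
  iter m f (iter n g x) = iter n g (iter m f x).
Proof. by move=> fg; elim: m => //= m ->; rewrite iter_commute1. Qed.

(** If commuting f and g are nilpotent at x, so is f - g: every monomial of
    (f - g)^(m + n) contains f^m or g^n. *)
Lemma iter_difference_eq0 (f g h : {additive U -> U}) m n x :
    (forall y, h y = f y - g y) -> (forall y, f (g y) = g (f y)) ->
  iter m f x = 0 -> iter n g x = 0 -> iter (m + n) h x = 0.
Proof.
move=> hE fg; have [k] := ubnP (m + n).
elim: k m n x => // k IHk [|m] [|n] x ltk fx gx.
- by [].
- by rewrite -[x]/(iter 0 f x) fx iter_additive0.
- by rewrite -[x]/(iter 0 g x) gx iter_additive0.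
rewrite addSn iterSr hE iter_additiveB.
(* h (iter _ h) x splits along h x = f x - g x, and f x (resp. g x) needs one
   application of f (resp. g) less than x to vanish. *)
have -> : iter (m + n.+1) h (f x) = 0.
  apply: IHk; first by lia.
    by rewrite -iterSr.
  by rewrite -iter_commute1 // gx raddf0.
rewrite -addSnnS (IHk m.+1 n) ?subr0 //; first by lia.
  by rewrite -iter_commute1 // fx raddf0.
by rewrite -iterSr.
Qed.

End Iterates.

(** * Distributions in two variables *)

Section TwoVariables.

Variable W : zmodType.
Implicit Type F : int -> int -> W.

Lemma mul_zw_is_zmod_morphism : zmod_morphism (@mul_zw W).
Proof.
move=> F G; apply/funext => m; apply/funext => n.
exact: subrACA.
Qed.

HB.instance Definition _ :=
  GRing.isZmodMorphism.Build _ _ (@mul_zw W) mul_zw_is_zmod_morphism.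

Lemma iter_mul_zwS j F m n :
  iter j.+1 (@mul_zw W) F m n =
  iter j (@mul_zw W) F (m + 1) n - iter j (@mul_zw W) F m (n + 1).
Proof. by []. Qed.

Lemma iter_mul_zw_map (W' : zmodType) (phi : {additive W -> W'}) N F :
  iter N (@mul_zw W') (fun m n => phi (F m n)) =
  fun m n => phi (iter N (@mul_zw W) F m n).
Proof.
elim: N => //= N ->; apply/funext => m; apply/funext => n.
by rewrite /mul_zw raddfB.
Qed.

(** A local distribution without negative powers of w is zero, but only its
    value at w = 0 is needed: (z - w) F at w = 0 is z F at w = 0. *)
Lemma regular_local_eq0 N F :
    (forall m n, 0 <= n -> F m n = 0) ->
  iter N (@mul_zw W) F = 0 -> forall m, F m (-1) = 0.
Proof.
elim: N F => [|N IHN] F F0 DF0 m; first by rewrite [F]DF0.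
have DF m' n : 0 <= n -> mul_zw F m' n = 0.
  by move=> n_ge0; rewrite /mul_zw !F0 ?subr0 //; lia.
have := IHN _ DF; rewrite -iterSr => /(_ DF0 (m - 1)).
by rewrite /mul_zw subrK addNr (F0 _ 0) ?subr0.
Qed.

(** Without terms z^(-m-1) w^(-n-1) for m, n >= 0, the part of F that is
    singular in z has a value at w = 0, where (z - w)^j acts as z^j. *)
Lemma iter_mul_zw_regular j F :
    (forall m n, 0 <= m -> 0 <= n -> F m n = 0) ->
  (forall m n, 0 <= m -> 0 <= n -> iter j (@mul_zw W) F m n = 0) /\
  (forall m, 0 <= m -> iter j (@mul_zw W) F m (-1) = F (m + j%:Z) (-1)).
Proof.
move=> F0; elim: j => [|j [IH0 IH1]]; first by split=> // m _; rewrite addr0.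
split=> [m n m_ge0 n_ge0|m m_ge0]; rewrite iter_mul_zwS.
  by rewrite !IH0 ?subr0 //; lia.
rewrite [X in _ - X]IH0 // subr0 IH1; last by lia.
by congr F; lia.
Qed.

(** The coefficient F m n is Res_z z^m F, and z^m = ((z - w) + w)^m. *)
Lemma binomial_expansion F (m : nat) n :
  F m n = \sum_(j < m.+1) iter j (@mul_zw W) F 0 (m%:Z + n - j%:Z) *+ 'C(m, j).
Proof.
elim: m F n => [|m IHm] F n.
  by rewrite big_ord1 /= add0r subr0 mulr1n.
have -> : F m.+1 n = mul_zw F m n + F m (n + 1).
  by rewrite /mul_zw subrK; congr F; lia.
rewrite !IHm [RHS]big_ord_recl /= bin0 [X in _ + X]big_ord_recl /= bin0.
under [in RHS]eq_bigr => i _ do rewrite /bump /= add1n binS mulrnDr.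
rewrite big_split /= addrCA; congr (_ + _).
  by rewrite subr0; congr (F _ _ *+ _); lia.
rewrite addrC; congr (_ + _).
  rewrite [in RHS]big_ord_recr /= bin_small // mulr0n addr0.
  apply: eq_bigr => i _; rewrite /bump /= add1n; congr (_ *+ _).
  by rewrite /mul_zw; congr (_ - _); congr (iter _ _ _ _ _); lia.
apply: eq_bigr => i _; rewrite -iterSr /=; congr (_ *+ _).
by rewrite /mul_zw; congr (_ - _); congr (iter _ _ _ _ _); lia.
Qed.

(** The coefficient F (-1) n is Res_z z^(-1) F, and
    z^(-1) = w^(-1) - z^(-1) w^(-1) (z - w), which is iterated until (z - w)^N
    kills F. *)
Lemma geometric_expansion N F n : iter N (@mul_zw W) F = 0 ->
  F (-1) n =
    \sum_(j < N) iter j (@mul_zw W) F 0 (n - 1 - j%:Z) *~ (-1) ^+ j.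
Proof.
elim: N F n => [|N IHN] F n; first by rewrite big_ord0 => /= ->.
rewrite iterSr => DF0.
have -> : F (-1) n = F 0 (n - 1) - mul_zw F (-1) (n - 1).
  by rewrite /mul_zw subrK addNr opprB addrC subrK.
rewrite (IHN _ _ DF0) big_ord_recl /= subr0 -sumrN; congr (_ + _).
apply: eq_bigr => i _; rewrite -iterSr /= /bump /= exprS mulN1r mulrNz.
by rewrite /mul_zw; congr (- ((_ - _) *~ _)); congr (iter _ _ _ _ _); lia.
Qed.

(** If phi acts on F as d/dz + d/dw, it does so on (z - w) F as well, because
    d/dz + d/dw kills z - w. *)
Lemma mul_zw_derivation (phi : {additive W -> W}) F :
    (forall m n, phi (F m n) = - (F (m - 1) n *~ m + F m (n - 1) *~ n)) ->
  forall m n, phi (mul_zw F m n)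
    = - (mul_zw F (m - 1) n *~ m + mul_zw F m (n - 1) *~ n).
Proof.
move=> phiF m n; rewrite /mul_zw raddfB !phiF /= !addrK.
rewrite !mulrzBl !mulrzDr mulr1z opprK.
rewrite [X in - X + _]addrAC opprD [X in _ + X]addrA [LHS]addrC addrACA.
by rewrite subrr addr0 [in RHS]addrACA -opprD opprB.
Qed.

Definition deriv_z F : int -> int -> W := fun m n => - (F (m - 1) n *~ m).

Lemma mul_zw_deriv_z F : mul_zw (deriv_z F) = deriv_z (mul_zw F) - F.
Proof.
apply/funext => m; apply/funext => n.
rewrite -[RHS]/(deriv_z (mul_zw F) m n - F m n) /mul_zw /deriv_z !addrK.
rewrite mulrzDr mulr1z mulrzBl opprB opprK opprD [LHS]addrAC.
by congr (_ + _); rewrite addrC.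
Qed.

(** Since d/dz (z - w)^(N + 1) is a multiple of (z - w)^N, a z-derivative costs
    one order of locality. *)
Lemma iter_mul_zw_deriv_z N F :
  iter N (@mul_zw W) F = 0 -> iter N.+1 (@mul_zw W) (deriv_z F) = 0.
Proof.
elim: N F => [|N IHN] F DF0.
  rewrite -[F]/(iter 0 (@mul_zw W) F) DF0 iterSr mul_zw_deriv_z raddf0 subr0.
  apply/funext => m; apply/funext => n.
  by rewrite -[LHS]/(- ((0 : W) *~ m)) mul0rz oppr0.
rewrite iterSr mul_zw_deriv_z iter_additiveB DF0 subr0 IHN //.
by rewrite -iterSr.
Qed.

End TwoVariables.

Lemma iter_mul_zw_morphD (U : zmodType) (F : int -> int -> U -> U) j :
    (forall m n, {morph F m n : x y / x + y}) ->
  forall m n, {morph iter j (@mul_zw (U -> U)) F m n : x y / x + y}.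
Proof.
elim: j => // j IHj F_add m n x y; rewrite iter_mul_zwS.
set f := iter _ _ _ _ _; set g := iter _ _ _ _ _.
rewrite -[LHS]/(f (x + y) - g (x + y)) -[RHS]/((f x - g x) + (f y - g y)).
by rewrite /f /g !IHj // opprD addrACA.
Qed.

(** * Distributions in three variables and Dong's lemma *)

Section ThreeVariables.

Variable W : zmodType.
Implicit Type H : int -> int -> int -> W.

Definition mul_zu H : int -> int -> int -> W :=
  fun k m n => H (k + 1) m n - H k m (n + 1).

Definition mul_wu H : int -> int -> int -> W := fun k => mul_zw (H k).

Lemma mul_zu_is_zmod_morphism : zmod_morphism mul_zu.
Proof.
move=> H H'; apply/funext => k; apply/funext => m; apply/funext => n.
exact: (congr1 (fun F => F k n)
  (raddfB (@mul_zw W) (fun k n => H k m n) (fun k n => H' k m n))).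
Qed.

HB.instance Definition _ :=
  GRing.isZmodMorphism.Build _ _ mul_zu mul_zu_is_zmod_morphism.

Lemma mul_wu_is_zmod_morphism : zmod_morphism mul_wu.
Proof. by move=> H H'; apply/funext => k; exact: raddfB. Qed.

HB.instance Definition _ :=
  GRing.isZmodMorphism.Build _ _ mul_wu mul_wu_is_zmod_morphism.

(* Multiplication by z - w leaves the last index alone, so it is the operation
   in two variables with coefficients depending on u. *)
Local Notation mul_zw3 := (@mul_zw (int -> W)).

Lemma mul_wuE H : mul_wu H = mul_zu H - mul_zw3 H.
Proof.
apply/funext => k; apply/funext => m; apply/funext => n.
rewrite -[RHS]/((H (k + 1) m n - H k m (n + 1)) -
                (H (k + 1) m n - H k (m + 1) n)).
by rewrite opprB addrC addrA subrK.
Qed.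

Lemma mul_zu_zwC H : mul_zu (mul_zw3 H) = mul_zw3 (mul_zu H).
Proof.
apply/funext => k; apply/funext => m; apply/funext => n.
exact: subrACA.
Qed.

Lemma mul_zu_wuC H : mul_zu (mul_wu H) = mul_wu (mul_zu H).
Proof. by rewrite !mul_wuE raddfB /= mul_zu_zwC. Qed.

Lemma mul_wu_zwC H : mul_wu (mul_zw3 H) = mul_zw3 (mul_wu H).
Proof. by rewrite !mul_wuE [RHS]raddfB /= mul_zu_zwC. Qed.

Lemma iter_mul_wu N H k : iter N mul_wu H k = iter N (@mul_zw W) (H k).
Proof. by elim: N => //= N <-. Qed.

Lemma iter_mul_zu N H k m n :
  iter N mul_zu H k m n = iter N (@mul_zw W) (fun k n => H k m n) k n.
Proof. by elim: N k n => //= N IHN k n; rewrite /mul_zu /mul_zw !IHN. Qed.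

Lemma iter_mul_zw3 N H k m n :
  iter N mul_zw3 H k m n =
  iter N (@mul_zw W) (fun k m => H k m n) k m.
Proof.
elim: N k m => //= N IHN k m.
by rewrite [RHS]/mul_zw -!IHN.
Qed.

(** After multiplication by (w - u)^N1 only G2 is left, which is killed by
    powers of both z - u and z - w, hence of their difference w - u. *)
Lemma dong_locality N1 N2 N3 G1 G2 :
    iter N1 mul_wu G1 = 0 -> iter N2 mul_zu G2 = 0 ->
    iter N3 mul_zw3 (G1 + G2) = 0 ->
  exists N, iter N mul_wu (G1 + G2) = 0.
Proof.
move=> G1_0 G2_0 G_0; exists (N2 + N3 + N1)%N.
rewrite iterD; apply: (@iter_difference_eq0 _ mul_zu mul_zw3 mul_wu).
- exact: mul_wuE.
- exact: mul_zu_zwC.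
- rewrite iter_additiveD G1_0 add0r.
  by rewrite (iter_commute _ _ _ mul_zu_wuC) G2_0 iter_additive0.
- by rewrite -(iter_commute _ _ _ mul_wu_zwC) G_0 iter_additive0.
Qed.

End ThreeVariables.

(** * Supercommutators *)

Section Evaluation.

Variables (U : Type) (W : zmodType) (u : U).

Definition eval_at (f : U -> W) : W := f u.

Lemma eval_at_is_zmod_morphism : zmod_morphism eval_at.
Proof. by []. Qed.

HB.instance Definition _ :=
  GRing.isZmodMorphism.Build _ _ eval_at eval_at_is_zmod_morphism.

Lemma mulrz_fctE (f : U -> W) (n : int) : (f *~ n) u = f u *~ n.
Proof. exact: (raddfMz eval_at). Qed.

End Evaluation.

Section Twist.

Variables (K : fieldType) (V : lmodType K).

(** With suitable scalars this is the supercommutator of f with g, or the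
    commutator of g with f. Allowing both scalars to vary gives a single family
    of maps, additive in f, that commutes with the multiplications by z - w,
    z - u and w - u and covers every bracket below. *)
Definition twist (c c' : K) (g : {linear V -> V}) (f : V -> V) : V -> V :=
  fun v => c *: f (g v) + c' *: g (f v).

Variables (c c' : K) (g : {linear V -> V}).

Lemma twist_is_zmod_morphism : zmod_morphism (twist c c' g).
Proof.
move=> f f'; apply/funext => v.
rewrite -[LHS]/(c *: (f (g v) - f' (g v)) + c' *: g (f v - f' v)).
rewrite -[RHS]/(c *: f (g v) + c' *: g (f v) -
                (c *: f' (g v) + c' *: g (f' v))).
by rewrite [g (_ - _)]linearB !scalerBr opprD addrACA.
Qed.

HB.instance Definition _ :=
  GRing.isZmodMorphism.Build _ _ (twist c c' g) twist_is_zmod_morphism.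

End Twist.

Section Supercommutators.

Variables (K : fieldType) (V : superspace K).
Implicit Types (A B C : distribution V) (p q r : bool).

Lemma koszulDl p q r : koszul K (p (+) q) r = koszul K p r * koszul K q r.
Proof.
by rewrite /koszul; case: p q r => [] [] [] /=;
  rewrite ?expr0 ?expr1 ?mulrNN ?mulr1 ?mul1r.
Qed.

Lemma koszul2 p q : koszul K p q * koszul K p q = 1.
Proof. by rewrite /koszul -expr2 sqrr_sign. Qed.

Lemma twist_scommutator p q A B m n :
  twist 1 (- koszul K p q) (B n) (A m) = scommutator p q A B m n.
Proof. by apply/funext => v; rewrite /twist scale1r scaleNr. Qed.

Lemma scommutator_morphD p q A B m n :
  {morph scommutator p q A B m n : x y / x + y}.
Proof.
by move=> x y; rewrite /scommutator [B n (_ + _)]linearD [A m (_ + _)]linearD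
  [A m (_ + _)]linearD [B n (_ + _)]linearD scalerDr opprD addrACA.
Qed.

(** The Jacobi identity for [[A, B], C], grouped so that the first summand is
    built from [B, C] and the second from [A, C]. *)
Lemma scommutator_super_jacobi p q r A B C k m n :
  twist 1 (- koszul K (p (+) q) r) (C n) (scommutator p q A B k m) =
  twist (- (koszul K p q * koszul K p r)) 1 (A k) (scommutator q r B C m n) +
  twist (koszul K q r) (- koszul K p q) (B m) (scommutator p r A C k n).
Proof.
apply/funext => v; rewrite koszulDl.
set x := koszul K p q; set y := koszul K p r; set z := koszul K q r.
rewrite -[RHS]/(twist _ _ _ _ _ + twist _ _ _ _ _) /twist /scommutator.
rewrite [C n (_ - _)]linearB [A k (_ - _)]linearB [B m (_ - _)]linearB.
rewrite [C n (_ *: _)]linearZ [A k (_ *: _)]linearZ [B m (_ *: _)]linearZ /=.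
rewrite !scale1r !scalerBr !scaleNr !scalerA.
rewrite -/x -/y -/z !opprK [z * y]mulrC [y * z * x]mulrC mulrA.
(* The four terms A C B and B C A of the right-hand side cancel in pairs. *)
rewrite !addrA [RHS](ACl ((3*7*6*2)*(8*1)*(5*4))) /=.
by rewrite !subrr !addr0.
Qed.

End Supercommutators.

(** * Uniqueness, the commutator formula and skew-symmetry *)

Section VertexAlgebra.

Variables (K : fieldType) (V : vertex_algebra K).
Hypothesis charK : forall n, (n.+1%:R : K) != 0.

Local Notation Y := (@va_Y K V).
Local Notation T := (va_T V).
Local Notation vac := (va_vac V).
Local Notation D := (@mul_zw (V -> V)).

Lemma mulrz_eq0_neg (v : V) (n : int) : n < 0 -> v *~ n = 0 -> v = 0.
Proof.
case: n => // n _ /eqP; rewrite -scaler_int scaler_eq0 NegzE mulrNz.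
by rewrite oppr_eq0 (negbTE (charK n)) => /eqP.
Qed.

Lemma va_T_modes a n v : T (Y a n v) = Y a n (T v) - Y a (n - 1) v *~ n.
Proof. by rewrite -scaler_int -va_translation addrC subrK. Qed.

Lemma va_Y_local p q a b : part p a -> part q b ->
  exists N, iter N D (scommutator p q (Y a) (Y b)) = 0.
Proof.
move=> pa qb.
have [N N0] : local_pair p q (Y a) (Y b).
  apply: va_local; [by exists a|by exists b| |]; exact: va_Y_parity.
by exists N; apply/funext => m; apply/funext => n; apply/funext => v; apply: N0.
Qed.

(** Goddard's uniqueness theorem. Covariance and T vac = 0 give
    n E_(n-1) vac = 0 by descending induction once E_n vac = 0, so E kills the
    vacuum. Then [E(z), Y(d,w)] vac = E(z) Y(d,w) vac has no negative powers of
    w and takes the value E(z) d at w = 0, so locality makes it vanish. The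
    sign s stands for the Koszul factor of E, whose parity is not fixed. *)
Lemma covariant_local_eq0 (E : int -> V -> V) (s : bool -> K) :
    (forall n, {morph E n : x y / x + y}) ->
    (forall n v, T (E n v) - E n (T v) = - (E (n - 1) v *~ n)) ->
    (forall n, -1 <= n -> E n vac = 0) ->
    (forall r d, part r d -> exists N,
      iter N D (fun m n => twist 1 (- s r) (Y d n) (E m)) = 0) ->
  forall n v, E n v = 0.
Proof.
move=> E_add ET E_reg E_loc.
have E0 n : E n 0 = 0 by apply: (addrI (E n 0)); rewrite -E_add !addr0.
have E_vac n : E n vac = 0.
  case: (leP (-1) n) => [/E_reg //|]; case: n => // n _.
  elim: n => [|n IHn]; first exact: E_reg.
  have := ET (Negz n) vac; rewrite va_T_vac IHn E0 raddf0 subr0 => /esym/eqP.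
  rewrite oppr_eq0 => /eqP /(mulrz_eq0_neg _) -/(_ isT).
  by congr (E _ _ = 0); lia.
have E_hom r d n : part r d -> E n d = 0.
  move=> /E_loc[N N0].
  have H0 m k : twist 1 (- s r) (Y d k) (E m) vac = E m (Y d k vac).
    by rewrite /twist E_vac raddf0 scaler0 addr0 scale1r.
  rewrite -[d in LHS]va_Y_create -H0.
  pose F m k := eval_at vac (twist 1 (- s r) (Y d k) (E m)).
  apply: (@regular_local_eq0 V N F) => [m k k_ge0|]; rewrite /F.
    by rewrite /eval_at H0 va_Y_regular.
  by rewrite iter_mul_zw_map N0.
move=> n v; have [v0 [v1 [/E_hom v0E /E_hom v1E ->]]] := part_span v.
by rewrite E_add v0E v1E addr0.
Qed.

(** The modes in w of Res_z (z - w)^j [Y(a,z), Y(b,w)]. *)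
Definition res_prod p q (a b : V) (j : nat) : int -> V -> V :=
  iter j D (scommutator p q (Y a) (Y b)) 0.

(** Taking Res_z (z - w)^j commutes with multiplication by w - u, so locality
    with d follows from Dong's lemma for [[Y(a,z), Y(b,w)], Y(d,u)]. *)
Lemma res_prod_local p q r (a b d : V) j :
    part p a -> part q b -> part r d -> exists N,
  iter N D (fun m n => twist 1 (- koszul K (p (+) q) r) (Y d n)
                             (res_prod p q a b j m)) = 0.
Proof.
move=> pa qb rd.
have [N1 bd0] := va_Y_local qb rd; have [N2 ad0] := va_Y_local pa rd.
have [N3 ab0] := va_Y_local pa qb.
pose G1 k m n := twist (- (koszul K p q * koszul K p r)) 1 (Y a k)
                       (scommutator q r (Y b) (Y d) m n).
pose G2 k m n := twist (koszul K q r) (- koszul K p q) (Y b m)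
                       (scommutator p r (Y a) (Y d) k n).
have GE : G1 + G2 = fun k m n => twist 1 (- koszul K (p (+) q) r) (Y d n)
                                  (scommutator p q (Y a) (Y b) k m).
  apply/funext => k; apply/funext => m; apply/funext => n.
  by rewrite scommutator_super_jacobi.
have G10 : iter N1 (@mul_wu (V -> V)) G1 = 0.
  apply/funext => k; rewrite iter_mul_wu iter_mul_zw_map bd0.
  by apply/funext => m; apply/funext => n; rewrite raddf0.
have G20 : iter N2 (@mul_zu (V -> V)) G2 = 0.
  apply/funext => k; apply/funext => m; apply/funext => n.
  by rewrite iter_mul_zu iter_mul_zw_map ad0 raddf0.
have iterG i k m n : iter i (@mul_zw (int -> V -> V)) (G1 + G2) k m n =
    twist 1 (- koszul K (p (+) q) r) (Y d n)
      (iter i D (scommutator p q (Y a) (Y b)) k m).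
  by rewrite iter_mul_zw3 GE iter_mul_zw_map.
have G0 : iter N3 (@mul_zw (int -> V -> V)) (G1 + G2) = 0.
  apply/funext => k; apply/funext => m; apply/funext => n.
  by rewrite iterG ab0 raddf0.
have [N N0] := dong_locality G10 G20 G0; exists N.
have -> : (fun m n => twist 1 (- koszul K (p (+) q) r) (Y d n)
             (res_prod p q a b j m)) =
    iter j (@mul_zw (int -> V -> V)) (G1 + G2) 0.
  by apply/funext => m; apply/funext => n; rewrite iterG.
rewrite -iter_mul_wu (iter_commute _ _ _ (@mul_wu_zwC _)) N0.
by rewrite iter_additive0.
Qed.

Definition ad_T : (V -> V) -> V -> V := twist (-1) 1 T.

Lemma ad_TE f v : ad_T f v = T (f v) - f (T v).
Proof. by rewrite /ad_T /twist scaleN1r scale1r addrC. Qed.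

Lemma ad_T_scommutator p q a b m n :
  ad_T (scommutator p q (Y a) (Y b) m n) =
  - (scommutator p q (Y a) (Y b) (m - 1) n *~ m +
     scommutator p q (Y a) (Y b) m (n - 1) *~ n).
Proof.
have modes a' b' k l v : T (Y a' k (Y b' l v)) = Y a' k (Y b' l (T v)) -
    (Y a' (k - 1) (Y b' l v) *~ k + Y a' k (Y b' (l - 1) v) *~ l).
  rewrite va_T_modes [T (Y b' l v)]va_T_modes linearB /= raddfMz.
  by rewrite opprD addrA addrAC.
apply/funext => v; rewrite ad_TE.
rewrite -[RHS]/(- ((_ *~ _) v + (_ *~ _) v)) !mulrz_fctE /scommutator.
rewrite [T (_ - _)]linearB [T (_ *: _)]linearZ /= !modes !mulrzBl.
rewrite !scalerMzr scalerBr subrACA [X in X - _]addrAC [X in _ - X]addrAC.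
rewrite !subrr !add0r -opprD; congr (- _).
by rewrite [X in _ *: X]addrC scalerDr opprD addrACA.
Qed.

(** The map ad_T acts on the supercommutator as d/dz + d/dw, which commutes
    with z - w, and the residue kills d/dz. *)
Lemma res_prod_translation p q a b j n v :
  T (res_prod p q a b j n v) - res_prod p q a b j n (T v) =
  - (res_prod p q a b j (n - 1) v *~ n).
Proof.
pose F i := iter i D (scommutator p q (Y a) (Y b)).
have FE i m k : ad_T (F i m k) = - (F i (m - 1) k *~ m + F i m (k - 1) *~ k).
  elim: i m k => [|i IHi] m k; first exact: ad_T_scommutator.
  exact: mul_zw_derivation IHi m k.
rewrite -ad_TE /res_prod -/(F j) FE mulr0z add0r.
by rewrite -[LHS]/(- ((_ *~ _) v)) mulrz_fctE.
Qed.

Lemma scommutator_vac p q a b (m n : int) : 0 <= m ->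
  scommutator p q (Y a) (Y b) m n vac = Y a m (Y b n vac).
Proof.
move=> m_ge0; rewrite /scommutator [Y a m vac]va_Y_regular //.
by rewrite [Y b n 0]linear0 scaler0 subr0.
Qed.

Lemma iter_scommutator_vac p q a b j m n :
  iter j D (scommutator p q (Y a) (Y b)) m n vac =
  iter j (@mul_zw V) (fun m n => scommutator p q (Y a) (Y b) m n vac) m n.
Proof.
exact: esym (congr1 (fun F => F m n) (iter_mul_zw_map (eval_at vac) j _)).
Qed.

(** As a_(m) vac = 0 for m >= 0, only Y(a,z) Y(b,w) vac contributes to the
    residue, and its value at w = 0 is Y(a,z) b. *)
Lemma res_prod_vac p q a b j n : -1 <= n ->
  res_prod p q a b j n vac = if n == -1 then Y a j b else 0.
Proof.
move=> n_ge; rewrite /res_prod iter_scommutator_vac.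
set F := fun _ => _.
have F0 (m k : int) : 0 <= m -> 0 <= k -> F m k = 0.
  move=> m_ge0 k_ge0; rewrite /F scommutator_vac //.
  by rewrite [Y b k vac]va_Y_regular // linear0.
have [F1 F2] := iter_mul_zw_regular j F0.
case: eqP => [->|nN1]; last by rewrite F1 //; lia.
by rewrite F2 // add0r /F scommutator_vac // va_Y_create.
Qed.

Lemma res_prodE p q a b j : part p a -> part q b ->
  res_prod p q a b j = fun n v => Y (Y a j b) n v.
Proof.
move=> pa qb; apply/funext => n; apply/funext => v; apply/eqP.
rewrite -subr_eq0; apply/eqP.
have pab : part (p (+) q) (Y a j b) by exact: (va_Y_parity pa).
pose E n : V -> V := res_prod p q a b j n - (Y (Y a j b) n : V -> V).
have E_E k u : E k u = res_prod p q a b j k u - Y (Y a j b) k u by [].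
rewrite -E_E; apply: (@covariant_local_eq0 E (koszul K (p (+) q))).
- move=> k x y; rewrite !E_E linearD opprD addrACA; congr (_ + _).
  by apply: iter_mul_zw_morphD => *; exact: scommutator_morphD.
- move=> k u; rewrite !E_E [T (_ - _)]linearB /= subrACA res_prod_translation.
  by rewrite va_translation scaler_int mulrzBl opprK opprB addrC.
- move=> k k_ge; rewrite E_E res_prod_vac //; case: eqP => [->|kN1].
    by rewrite va_Y_create subrr.
  by rewrite va_Y_regular ?subr0 //; lia.
move=> r d rd; have [N1 N10] := res_prod_local j pa qb rd.
have [N2 N20] := va_Y_local pab rd; exists (maxn N1 N2).
have -> : (fun m k => twist 1 (- koszul K (p (+) q) r) (Y d k) (E m)) =
    (fun m k => twist 1 (- koszul K (p (+) q) r) (Y d k)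
                      (res_prod p q a b j m)) -
    scommutator (p (+) q) r (Y (Y a j b)) (Y d).
  apply/funext => m; apply/funext => k; rewrite /E raddfB.
  by congr (_ - _); exact: twist_scommutator.
rewrite iter_additiveB (iter_additive_eq0W (leq_maxl N1 N2)) //.
by rewrite (iter_additive_eq0W (leq_maxr N1 N2)) ?subrr.
Qed.

Lemma commutator_formula p q a b (m : nat) n v : part p a -> part q b ->
  Y a m (Y b n v) = \sum_(j < m.+1) Y (Y a j b) (m%:Z + n - j%:Z) v *+ 'C(m, j)
                    + koszul K p q *: Y b n (Y a m v).
Proof.
move=> pa qb; apply/eqP; rewrite -subr_eq; apply/eqP.
have := binomial_expansion (scommutator p q (Y a) (Y b)) m n.
move=> /(congr1 (eval_at v)); rewrite raddf_sum => /= E.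
rewrite [LHS]E; apply: eq_bigr => j _; rewrite raddfMn.
by rewrite -[iter _ _ _ _]/(res_prod p q a b j) res_prodE.
Qed.

(** In series form: Y(c,z) vac = exp(z T) c. *)
Lemma va_creation_series c (k : nat) :
  iter k T c = Y c (- k.+1%:Z) vac *+ k`!.
Proof.
elim: k => [|k IHk]; first by rewrite va_Y_create.
rewrite iterS IHk raddfMn /= va_T_modes va_T_vac linear0 sub0r.
rewrite mulrNz opprK factS mulrnA; congr (_ *+ _).
by rewrite -pmulrn; congr (va_Y _ _ _ *+ _); lia.
Qed.

(** The mode a_(-1) b_(n) - b_(n) a_(-1) of the supercommutator, applied to the
    vacuum, is the single term - b_(n) a, because b_(n) vac = 0 for n >= 0 and
    a_(-1) vac = a. *)
Lemma skew_modes p q a b (n : nat) : part p a -> part q b ->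
  exists N0, forall N, (N0 <= N)%N -> Y b n a =
  - (koszul K p q *:
      \sum_(j < N) Y (Y a j b) (n%:Z - 1 - j%:Z) vac *~ (-1) ^+ j).
Proof.
move=> pa qb; have [N0 ab0] := va_Y_local pa qb; exists N0 => N leN.
have {}ab0 := iter_additive_eq0W leN ab0.
have := congr1 (eval_at vac) (geometric_expansion n ab0).
rewrite [LHS]/(eval_at _ _) /eval_at /scommutator va_Y_regular // linear0.
rewrite sub0r va_Y_create => E.
rewrite -[LHS]scale1r -(koszul2 K p q) -scalerA.
rewrite -[koszul K p q *: Y b n a]opprK E scalerN.
congr (- (_ *: _)); rewrite -[LHS]/(eval_at vac _) raddf_sum.
apply: eq_bigr => j _; rewrite raddfMz.
by rewrite -[iter _ _ _ _]/(res_prod p q a b j) res_prodE.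
Qed.

(** Y(T a, z) and d/dz Y(a, z) are covariant, local with all fields, and agree
    on the vacuum at z = 0, hence they coincide. *)
Lemma va_Y_T a n v : Y (T a) n v = - (Y a (n - 1) v *~ n).
Proof.
have Yadd m u : {morph (fun c => Y c m u) : x y / x + y}.
  by move=> x y; have := @va_Y_linear K V m u 1 x y; rewrite !scale1r.
wlog [p pa] : a / exists p, part p a.
  move=> IH; have [a0 [a1 [a0E a1O ->]]] := part_span a.
  rewrite linearD !Yadd !IH; [|by exists true|by exists false].
  by rewrite mulrzDl opprD.
apply/eqP; rewrite -subr_eq0 opprK; apply/eqP.
have pTa : part p (T a) by exact: (va_T_even pa).
pose E m : V -> V :=
  (Y (T a) m : V -> V) - deriv_z (fun m _ => Y a m : V -> V) m 0.
have E_E m u : E m u = Y (T a) m u + Y a (m - 1) u *~ m.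
  by rewrite /E /deriv_z opprK -[LHS]/(_ + (_ *~ _) u) mulrz_fctE.
rewrite -E_E; apply: (@covariant_local_eq0 E (koszul K p)).
- by move=> m x y; rewrite !E_E !linearD mulrzDl addrACA.
- move=> m u; rewrite !E_E linearD /= raddfMz /= opprD addrACA.
  rewrite va_translation -mulrzBl va_translation !scaler_int.
  by rewrite mulrzDl opprD mulNrz -!mulrzA mulrC.
- move=> m m_ge; rewrite E_E; case: (leP 0 m) => m0.
    case: (m =P 0) => [->|nm0]; first by rewrite mulr0z va_Y_regular ?addr0.
    by rewrite !va_Y_regular ?mul0rz ?addr0 //; lia.
  have -> : m = -1 by lia.
  rewrite va_Y_create -[T a]/(iter 1 T a) va_creation_series mulrNz.
  by rewrite mulr1z mulr1n subrr.
move=> r d rd; have [N1 N10] := va_Y_local pTa rd.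
have [N2 N20] := va_Y_local pa rd; exists (maxn N1 N2.+1).
have -> : (fun m k => twist 1 (- koszul K p r) (Y d k) (E m)) =
    scommutator p r (Y (T a)) (Y d) - deriv_z (scommutator p r (Y a) (Y d)).
  apply/funext => m; apply/funext => k; rewrite /E raddfB.
  congr (_ - _); first exact: twist_scommutator.
  rewrite /deriv_z raddfN raddfMz; congr (- (_ *~ _)).
  exact: twist_scommutator.
rewrite iter_additiveB (iter_additive_eq0W (leq_maxl _ _)) // sub0r.
by rewrite (iter_additive_eq0W (leq_maxr _ _)) ?oppr0 ?iter_mul_zw_deriv_z.
Qed.

End VertexAlgebra.

(** * Substitutions into polynomials in lambda and mu *)

Section Substitution.

Lemma lsubstE (U W : zmodType) (S : W -> W) (inj : U -> W) f N :
    S 0 = 0 -> inj 0 = 0 -> (forall n, (N <= n)%N -> f n = 0) ->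
  lsubst S inj f = \sum_(k < N) iter k S (inj (f k)).
Proof.
move=> S0 inj0 fN; rewrite /lsubst.
rewrite (fsbig_ord _ N (fun k => iter k S (inj (f k)))).
apply/esym/fsbig_widen => // k [_ /negP]; rewrite -leqNgt => /fN /= ->.
by rewrite inj0; elim: k => //= k ->.
Qed.

Variables (K : fieldType) (V : lmodType K).
Implicit Types (v : V) (f : nat -> V).

Lemma iter_lmul2 (F : nat -> nat -> V) k m n :
  iter k (@lmul2 K V) F m n = if (k <= m)%N then F (m - k)%N n else 0.
Proof. by elim: k m => [|k IHk] [|m] //=; rewrite ?subn0 // IHk. Qed.

(** The binomial expansion of (lambda + mu)^k. *)
Lemma iter_lmmul2_const v k m n :
  iter k (fun F : nat -> nat -> V => lmul2 F + mmul2 F) (lconst2 v) m n =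
  v *+ ((m + n == k) * 'C(k, n))%N.
Proof.
elim: k m n => [|k IHk] m n.
  by rewrite /= /lconst2; case: m n => [|m] [|n]; rewrite ?mulr0n.
rewrite iterS -[LHS]/(lmul2 _ m n + mmul2 _ m n) /lmul2 /mmul2 /lmul.
case: m n => [|m] [|n]; rewrite ?IHk ?addr0 ?add0r //.
- by rewrite !add0n eqSS; case: eqP => [->|//]; rewrite !binn.
- by rewrite !addn0 eqSS !bin0.
by rewrite -mulrnDr !addSn !addnS eqSS -mulnDr binS.
Qed.

(** The binomial expansion of (- lambda - d)^k applied to v. *)
Lemma iter_neg_const (d : {linear V -> V}) v k n :
  iter k (fun g : nat -> V => - lmul g - (d \o g)) (lconst v) n =
  iter (k - n)%N d v *~ (-1) ^+ k *+ 'C(k, n).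
Proof.
elim: k n => [|k IHk] n; first by case: n.
rewrite iterS -[LHS]/(- lmul _ n - d _) /lmul IHk.
rewrite raddfMn raddfMz -iterS exprS mulN1r mulrNz mulNrn.
case: n => [|n]; first by rewrite oppr0 add0r subn0 !bin0.
rewrite IHk binS mulrnDr opprD addrC subSS; congr (- _ - _).
by case: (ltnP n k) => ltnk; [rewrite -subSn | rewrite bin_small].
Qed.

Lemma subst_negE (d : {linear V -> V}) f N n :
    (forall k, (N <= k)%N -> f k = 0) ->
  subst_neg d f n =
  \sum_(k < N) iter (k - n)%N d (f k) *~ (-1) ^+ k *+ 'C(k, n).
Proof.
move=> fN; rewrite /subst_neg (lsubstE _ _ fN).
- rewrite fct_sumE; apply: eq_bigr => k _; exact: iter_neg_const.
- apply/funext => -[|k]; rewrite -[LHS]/(- _ - d 0) linear0 subr0 ?oppr0 //.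
by apply/funext => -[].
Qed.

Variable br : V -> V -> nat -> V.
Hypothesis br_poly : forall a b, is_lpoly (br a b).

Lemma br_sumE x c m n : br_sum br x c m n = br x c (m + n)%N *+ 'C(m + n, n).
Proof.
have [N brN] := br_poly x c.
pose M := maxn N (m + n).+1.
have brM k : (M <= k)%N -> br x c k = 0 by move=> ?; apply: brN; lia.
have mnM : (m + n < M)%N by rewrite leq_maxr.
rewrite /br_sum (lsubstE _ _ brM).
- rewrite !fct_sumE (bigD1 (Ordinal mnM)) //= iter_lmmul2_const eqxx mul1n.
  rewrite big1 ?addr0 // => k nk.
  rewrite iter_lmmul2_const; case: eqP => [E|]; last by rewrite mulr0n.
  by case/eqP: nk; apply: val_inj.
- apply/funext => k; apply/funext => l.
  rewrite -[LHS]/(lmul2 0 k l + mmul2 0 k l).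
  by case: k l => [|k] [|l]; rewrite /lmul2 /mmul2 /= addr0.
by apply/funext => k; apply/funext => l; rewrite /lconst2 if_same.
Qed.

Lemma br_br_sumE a b c m n : br 0 c = 0 ->
  br_br_sum br a b c m n =
  \sum_(j < m.+1) br (br a b j) c (m - j + n)%N *+ 'C(m - j + n, n).
Proof.
move=> br0; have [N brN] := br_poly a b.
pose M := maxn N m.+1.
have brM k : (M <= k)%N -> br a b k = 0 by move=> ?; apply: brN; lia.
have br_sum0 : br_sum br 0 c = 0.
  by apply/funext => k; apply/funext => l; rewrite br_sumE br0 mul0rn.
rewrite /br_br_sum (lsubstE _ _ brM) //; last first.
  by apply/funext => -[].
pose G j := br (br a b j) c (m - j + n)%N *+ 'C(m - j + n, n).
rewrite !fct_sumE [RHS](big_ord_widen M G) ?leq_maxr //.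
rewrite [RHS]big_mkcond /=; apply: eq_bigr => k _.
by rewrite iter_lmul2 ltnS br_sumE.
Qed.

End Substitution.

(** * The lambda-bracket of a vertex algebra *)

Section Bracket.

Variables (K : fieldType) (V : vertex_algebra K).
Hypothesis charK : forall n, (n.+1%:R : K) != 0.

Local Notation Y := (@va_Y K V).
Local Notation T := (va_T V).
Local Notation br := (@va_bracket K V).

Lemma fact_neq0 n : (n`!%:R : K) != 0.
Proof. by rewrite -(prednK (fact_gt0 n)). Qed.

Lemma bin_neq0 n m : (m <= n)%N -> ('C(n, m)%:R : K) != 0.
Proof. by rewrite -bin_gt0 => /prednK <-. Qed.

Lemma skew_coefficient j n : (n <= j)%N ->
  (n`!%:R)^-1 = (j`!%:R)^-1 * (j - n)`!%:R * 'C(j, n)%:R :> K.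
Proof.
move=> le_nj; rewrite -(bin_fact le_nj) !natrM.
by field; rewrite !fact_neq0 bin_neq0.
Qed.

Lemma jacobi_coefficient j m n : (j <= m)%N ->
  'C(m - j + n, n)%:R / (m - j + n)`!%:R / j`!%:R
    = 'C(m, j)%:R * ((m`!%:R)^-1 / n`!%:R) :> K.
Proof.
move=> le_jm; have le_n := leq_addl (m - j) n.
rewrite -(bin_fact le_n) -(bin_fact le_jm) addnK !natrM.
by field; rewrite !fact_neq0 !bin_neq0.
Qed.

Lemma va_YZl (k : K) a n v : Y (k *: a) n v = k *: Y a n v.
Proof. exact: (scalable_linear (@va_Y_linear K V n v)). Qed.

Lemma va_bracket_poly a b : is_lpoly (br a b).
Proof.
have [N N0] := va_Y_field a b; exists `|N|%N => n le_n.
by rewrite va_bracketE N0 ?scaler0 //; lia.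
Qed.

Lemma va_bracket_linear_l b : linear (fun a => br a b).
Proof.
move=> k x y; apply/funext => n.
rewrite -[RHS]/(k *: br x b n + br y b n) !va_bracketE va_Y_linear.
by rewrite scalerDr !scalerA mulrC.
Qed.

Lemma va_bracket_linear_r a : linear (br a).
Proof.
move=> k x y; apply/funext => n.
rewrite -[RHS]/(k *: br a x n + br a y n) !va_bracketE linearP.
by rewrite scalerDr !scalerA mulrC.
Qed.

Lemma inv_fact_mulrz n (v : V) :
  (n.+1`!%:R : K)^-1 *: (v *~ n.+1) = (n`!%:R)^-1 *: v.
Proof.
rewrite -scaler_int scalerA factS natrM; congr (_ *: _).
by rewrite -pmulrn; field; rewrite -mulrS fact_neq0 charK.
Qed.

Lemma va_bracket_sesq_l a b : br (T a) b = - lmul (br a b).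
Proof.
apply/funext => n; rewrite -[RHS]/(- lmul _ n) va_bracketE va_Y_T //.
case: n => [|n]; first by rewrite mulr0z oppr0 scaler0.
rewrite /lmul va_bracketE scalerN inv_fact_mulrz.
by congr (- (_ *: va_Y _ _ _)); lia.
Qed.

Lemma va_bracket_sesq_r a b : br a (T b) = (T \o br a b) + lmul (br a b).
Proof.
apply/funext => n; rewrite -[RHS]/(T (br a b n) + lmul _ n) !va_bracketE.
rewrite [T (_ *: _)]linearZ /= va_T_modes scalerBr.
case: n => [|n]; first by rewrite mulr0z scaler0 subr0 addr0.
rewrite /lmul va_bracketE inv_fact_mulrz.
have -> : n.+1%:Z - 1 = n%:Z by lia.
by rewrite subrK.
Qed.

Lemma va_bracket_skew p q a b : part p a -> part q b ->
  br b a = - (koszul K p q *: subst_neg T (br a b)).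
Proof.
move=> pa qb; apply/funext => n.
rewrite -[RHS]/(- (koszul K p q *: subst_neg T (br a b) n)) va_bracketE.
have [N1 skew] := skew_modes charK n pa qb.
have [N2 poly] := va_bracket_poly a b.
rewrite (skew (maxn N1 N2)) ?leq_maxl // scalerN scalerA mulrC -scalerA.
congr (- (_ *: _)).
have brN k : (maxn N1 N2 <= k)%N -> br a b k = 0 by move=> ?; apply: poly; lia.
rewrite (subst_negE _ _ brN) scaler_sumr; apply: eq_bigr => j _.
case: (leqP n j) => [le_nj|lt_jn]; last first.
  by rewrite bin_small // mulr0n va_Y_regular ?mul0rz ?scaler0 //; lia.
rewrite va_bracketE -(@iter_commute1 _ ( *:%R _)); last first.
  by move=> v; rewrite linearZ.
rewrite va_creation_series.
have -> : - (j - n).+1%:Z = n%:Z - 1 - j%:Z by lia.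
rewrite -!scaler_int -!scaler_nat !scalerA; congr (_ *: _).
by rewrite (skew_coefficient le_nj); ring.
Qed.

(** The coefficient of lambda^m mu^n is the commutator formula divided by
    m! n!; the factors C(m - j + n, n) come from expanding
    (lambda + mu)^(m - j + n). *)
Lemma va_bracket_jacobi p q a b c : part p a -> part q b ->
  br_lm br a b c = br_br_sum br a b c + koszul K p q *: br_ml br b a c.
Proof.
move=> pa qb; apply/funext => m; apply/funext => n.
rewrite -[RHS]/(br_br_sum br a b c m n + koszul K p q *: br_ml br b a c m n).
have br0 : br 0 c = 0.
  by apply/funext => k; rewrite va_bracketE -(scale0r 0) va_YZl scale0r scaler0.
rewrite (br_br_sumE va_bracket_poly) // /br_lm /br_ml !va_bracketE.
rewrite [Y a m (_ *: _)]linearZ [Y b n (_ *: _)]linearZ /=.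
rewrite (commutator_formula charK _ _ _ pa qb) !scalerA scalerDr; congr (_ + _).
  rewrite scaler_sumr; apply: eq_bigr => j _.
  have le_jm : (j <= m)%N by rewrite -ltnS.
  rewrite !va_bracketE va_YZl -!scalerMnr -!scaler_nat !scalerA.
  rewrite jacobi_coefficient //.
  by congr (_ *: va_Y _ _ _); lia.
by rewrite scalerA; congr (_ *: _); ring.
Qed.

Lemma va_lie_conformal : lie_conformal_superalgebra T br.
Proof.
split.
- exact: va_T_even.
- exact: va_bracket_poly.
- exact: va_bracket_linear_l.
- exact: va_bracket_linear_r.
- move=> p q a b k pa qb; rewrite va_bracketE -[_ *: _]addr0.
  by apply: part_lin (part0 _ _); exact: (va_Y_parity pa).
- exact: va_bracket_sesq_l.
- exact: va_bracket_sesq_r.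
- exact: va_bracket_skew.
- exact: va_bracket_jacobi.
Qed.

End Bracket.

Theorem proposition4p5p2 (R : realType) (V : vertex_algebra (complex R)) :
  lie_conformal_superalgebra (va_T V) (@va_bracket (complex R) V).
Proof. by apply: va_lie_conformal => n; rewrite pnatr_eq0. Qed.
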